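(* Let $A$ and $B$ be irreducible square matrices of size greater than $1$ with entries in $\{0,1\}$ satisfying condition (I). Suppose that $(X_A,\sigma_A)$ and $(X_B,\sigma_B)$ are continuously orbit equivalent through a homeomorphism $h:X_A\to X_B$, with continuous functions $k_1,l_1:X_A\to\mathbb{Z}_+$ and $k_2,l_2:X_B\to\mathbb{Z}_+$ satisfying $$\sigma_B^{k_1(x)}(h(\sigma_A(x)))=\sigma_B^{l_1(x)}(h(x))\ (x\in X_A),\qquad \sigma_A^{k_2(y)}(h^{-1}(\sigma_B(y)))=\sigma_A^{l_2(y)}(h^{-1}(y))\ (y\in X_B).$$ Put $c_1=l_1-k_1$ on $X_A$ and $c_2=l_2-k_2$ on $X_B$. Then the zeta functions $\zeta_A(t),\zeta_B(t)$ of the two-sided topological Markov shifts $(\bar X_A,\bar\sigma_A)$, $(\bar X_B,\bar\sigma_B)$ satisfy $$\zeta_A(t)=\zeta_{[c_2]}(t),\qquad \zeta_B(t)=\zeta_{[c_1]}(t).$$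
   Context: For an $N\times N$ matrix $A$ ($N>1$) with entries in $\{0,1\}$, $X_A=\{(x_n)_{n\ge1}\in\{1,\dots,N\}^{\mathbb{N}}: A(x_n,x_{n+1})=1\ \forall n\ge1\}$ with the product topology, and $\sigma_A:X_A\to X_A$ is the shift $(x_n)_n\mapsto(x_{n+1})_n$. The two-sided shift is $\bar X_A=\{(x_n)_{n\in\mathbb{Z}}: A(x_n,x_{n+1})=1\ \forall n\in\mathbb{Z}\}$ with shift homeomorphism $\bar\sigma_A((x_n)_{n})=(x_{n+1})_{n}$, and $\pi_A:\bar X_A\to X_A$, $\pi_A((x_n)_{n\in\mathbb{Z}})=(x_n)_{n\ge1}$. Condition (I) is that of Cuntz and Krieger; for an irreducible matrix it says that $A$ is not a permutation matrix, equivalently $X_A$ has no isolated points. $\mathbb{Z}_+=\{0,1,2,\dots\}$. $P_{orb}(\bar X_A)$ is the set of periodic (finite) orbits $\gamma$ of $(\bar X_A,\bar\sigma_A)$, and $|\gamma|$ is the cardinality of $\gamma$. With $\mathrm{Per}_n(\bar X_A)=\{\bar x\in\bar X_A:\bar\sigma_A^n(\bar x)=\bar x\}$, $$\zeta_A(t)=\exp\Bigl(\sum_{n=1}^\infty\frac{t^n}{n}|\mathrm{Per}_n(\bar X_A)|\Bigr)=\prod_{\gamma\in P_{orb}(\bar X_A)}(1-t^{|\gamma|})^{-1}.$$ For $f\in C(X_A,\mathbb{Z})$ and $\gamma\in P_{orb}(\bar X_A)$, $\beta_\gamma([f])=\sum_{\bar x\in\gamma}f(\pi_A(\bar x))$,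 which depends only on the class $[f]$ of $f$ in $H^A=C(X_A,\mathbb{Z})/\{\xi-\xi\circ\sigma_A:\xi\in C(X_A,\mathbb{Z})\}$. The zeta function of $[c_1]$ (which is an order unit of the ordered cohomology group of $(X_A,\sigma_A)$, so that $\beta_\gamma([c_1])>0$ for all $\gamma$) is $$\zeta_{[c_1]}(t)=\prod_{\gamma\in P_{orb}(\bar X_A)}(1-t^{\beta_\gamma([c_1])})^{-1},$$ and $\zeta_{[c_2]}(t)=\prod_{\gamma\in P_{orb}(\bar X_B)}(1-t^{\beta_\gamma([c_2])})^{-1}$ is defined in the same way with $B$ in place of $A$. All these may be read as identities of formal power series in $t$. *)

(* Defs.v *)
From HB Require Import structures.
From mathcomp Require Import all_boot all_order all_algebra finmap.
From mathcomp Require Import all_classical topology.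
Set Implicit Arguments.
Unset Strict Implicit.
Unset Printing Implicit Defensive.
Import Order.TTheory GRing.Theory Num.Theory.
Local Open Scope classical_set_scope.
Local Open Scope ring_scope.


Record fps := Fps { coef_fps :> nat -> rat }.

HB.instance Definition _ := gen_eqMixin fps.
HB.instance Definition _ := gen_choiceMixin fps.

Lemma fpsP (f g : fps) : (forall n, f n = g n) -> f = g.
Proof. by case: f g => f [g] /= fg; congr Fps; apply/funext. Qed.

Definition fpsC (a : rat) : fps := Fps (fun n => if n == 0%N then a else 0).
Definition fpsX : fps := Fps (fun n => (n == 1%N)%:R).
Definition fps_opp (f : fps) : fps := Fps (fun n => - f n).
Definition fps_add (f g : fps) : fps := Fps (fun n => f n + g n).
Definition fps_mul (f g : fps) : fps :=
  Fps (fun n => \sum_(i < n.+1) f i * g (n - i)%N).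

Fact fps_addA : associative fps_add.
Proof. by move=> f g h; apply: fpsP => n /=; rewrite addrA. Qed.
Fact fps_addC : commutative fps_add.
Proof. by move=> f g; apply: fpsP => n /=; rewrite addrC. Qed.
Fact fps_add0 : left_id (fpsC 0) fps_add.
Proof. by move=> f; apply: fpsP => n /=; rewrite if_same add0r. Qed.
Fact fps_addN : left_inverse (fpsC 0) fps_opp fps_add.
Proof. by move=> f; apply: fpsP => n /=; rewrite if_same addNr. Qed.

HB.instance Definition _ :=
  GRing.isZmodule.Build fps fps_addA fps_addC fps_add0 fps_addN.

Section Truncation.
Let trunc m (f : fps) : {poly rat} := \poly_(i < m.+1) f i.

Let coef_trunc_mul m f g n : (n <= m)%N ->
  (trunc m f * trunc m g)`_n = fps_mul f g n.
Proof.
move=> nm; rewrite coefM; apply: eq_bigr => -[i /= lti] _.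
rewrite !coef_poly !ltnS (leq_trans _ nm) ?(leq_trans (leq_subr _ _) nm) //.
Qed.

Fact fps_mulC : commutative fps_mul.
Proof.
by move=> f g; apply: fpsP => n; rewrite -!(coef_trunc_mul _ _ (leqnn n)) mulrC.
Qed.

Fact fps_mulA : associative fps_mul.
Proof.
move=> f g h; apply: fpsP => n.
have -> : fps_mul f (fps_mul g h) n = (trunc n f * (trunc n g * trunc n h))`_n.
  rewrite coefM; apply: eq_bigr => -[i /=]; rewrite ltnS => lei _.
  by rewrite coef_trunc_mul ?leq_subr // coef_poly ltnS lei.
rewrite mulrA coefM; apply: eq_bigr => -[i /=]; rewrite ltnS => lei _.
by rewrite coef_trunc_mul // coef_poly ltnS leq_subr.
Qed.
End Truncation.

Fact fps_mul1 : left_id (fpsC 1) fps_mul.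
Proof.
move=> f; apply: fpsP => n /=; rewrite big_ord_recl /= subn0 mul1r.
by rewrite big1 ?addr0 // => i _; rewrite mul0r.
Qed.
Fact fps_mulD : left_distributive fps_mul fps_add.
Proof.
move=> f g h; apply: fpsP => n /=; rewrite -big_split /=.
by apply: eq_bigr => i _; rewrite mulrDl.
Qed.
Fact fps_1neq0 : fpsC 1 != 0.
Proof. by apply/eqP => /(congr1 (fun f : fps => f 0%N)). Qed.

HB.instance Definition _ := GRing.Zmodule_isComNzRing.Build fps
  fps_mulA fps_mulC fps_mul1 fps_mulD fps_1neq0.

Lemma fpsDE (f g : fps) n : (f + g) n = f n + g n. Proof. by []. Qed.
Lemma fpsNE (f : fps) n : (- f) n = - f n. Proof. by []. Qed.
Lemma fps0E n : (0 : fps) n = 0. Proof. by rewrite /= if_same. Qed.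
Lemma fps1E n : (1 : fps) n = (n == 0%N)%:R. Proof. by case: n. Qed.
Lemma fpsME (f g : fps) n : (f * g) n = \sum_(i < n.+1) f i * g (n - i)%N.
Proof. by []. Qed.

Lemma fps_sumE I (r : seq I) (P : pred I) (F : I -> fps) n :
  (\sum_(i <- r | P i) F i) n = \sum_(i <- r | P i) F i n.
Proof.
elim/big_rec2: _ => [|i x f _ <-]; first exact: fps0E.
by rewrite fpsDE.
Qed.

Lemma fpsCM a (f : fps) n : (fpsC a * f) n = a * f n.
Proof.
rewrite fpsME big_ord_recl /= subn0 big1 ?addr0 // => i _.
by rewrite mul0r.
Qed.

Lemma fpsX_lt (u : fps) k n : u 0%N = 0 -> (n < k)%N -> (u ^+ k) n = 0.
Proof.
move=> u0; elim: k n => // k IHk n; rewrite ltnS => nk.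
rewrite exprS fpsME big_ord_recl u0 mul0r add0r big1 // => i _.
rewrite IHk ?mulr0 //=; move: nk (ltn_ord i); case: n i => [|n] i //.
by rewrite /bump /= add1n subSS => nk _; apply: leq_ltn_trans nk; rewrite leq_subr.
Qed.

(* The sum of the series [F 0 + F 1 + ...] when [F k] is divisible by [t ^ k]. *)
Definition fps_adic_sum (F : nat -> fps) : fps :=
  Fps (fun n => (\sum_(k < n.+1) F k) n).

(* Geometric series in [1 - f / f 0]. *)
Definition fps_inv (f : fps) : fps :=
  if f 0%N == 0 then f else
  fpsC (f 0%N)^-1 * fps_adic_sum (fun k => (1 - fpsC (f 0%N)^-1 * f) ^+ k).

Definition fps_unit : pred fps := fun f => f 0%N != 0.

Fact fps_mulVr : {in fps_unit, left_inverse 1 fps_inv *%R}.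
Proof.
move=> f; rewrite unfold_in /fps_inv => f0; rewrite (negPf f0).
set u := 1 - _; have u0 : u 0%N = 0.
  by rewrite fpsDE fpsNE fpsCM fps1E mulVf // subrr.
have fE : fpsC (f 0%N)^-1 * f = 1 - u by rewrite opprB addrC subrK.
rewrite mulrAC fE mulrC; apply: fpsP => n.
transitivity (((\sum_(k < n.+1) u ^+ k) * (1 - u)) n).
  rewrite !fpsME; apply: eq_bigr => -[i /=]; rewrite ltnS => lei _.
  congr (_ * _); rewrite !fps_sumE.
  rewrite (big_ord_widen n.+1 (fun k => (u ^+ k) i)) //.
  rewrite big_mkcond; apply: eq_bigr => k _; rewrite ltnS.
  by case: leqP => // ik; rewrite fpsX_lt.
rewrite mulrC -[X in X * _]opprB mulNr -subrX1 opprB fpsDE fpsNE fpsX_lt //.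
by rewrite subr0.
Qed.

Fact fps_unitP (f g : fps) : g * f = 1 -> fps_unit f.
Proof.
move=> /(congr1 (fun h : fps => h 0%N)); rewrite fpsME big_ord1 fps1E /=.
by apply: contra_eq_neq => -> ; rewrite mulr0 eq_sym oner_eq0.
Qed.

Fact fps_inv_out : {in [predC fps_unit], fps_inv =1 id}.
Proof. by move=> f; rewrite inE unfold_in negbK /fps_inv => ->. Qed.

HB.instance Definition _ := GRing.ComNzRing_hasMulInverse.Build fps
  fps_mulVr fps_unitP fps_inv_out.

(* Only meaningful when [f] has no constant term, since then [t ^ k] divides
   [f ^+ k]. *)
Definition fps_exp (f : fps) : fps :=
  fps_adic_sum (fun k => (k`!)%:R^-1 * f ^+ k).

(* Unconditional convergence of an infinite product, for the topology of
   coefficientwise stabilisation. *)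
Definition fps_has_prod (I : choiceType) (F : I -> fps) (P : fps) : Prop :=
  forall n, exists S0 : {fset I}, forall S : {fset I},
    (S0 `<=` S)%fset -> (\prod_(i <- S) F i) n = P n.

Definition fps_multipliable (I : choiceType) (F : I -> fps) : Prop :=
  exists P, fps_has_prod F P.

Definition fps_prod (I : choiceType) (F : I -> fps) : fps :=
  xget 0 [set P | fps_has_prod F P].

Lemma fps_has_prod_unique (I : choiceType) (F : I -> fps) P Q :
  fps_has_prod F P -> fps_has_prod F Q -> P = Q.
Proof.
move=> FP FQ; apply: fpsP => n; have [S SP] := FP n; have [T TQ] := FQ n.
by rewrite -(SP (S `|` T)%fset) ?fsubsetUl // TQ ?fsubsetUr.
Qed.

Lemma fps_prodP (I : choiceType) (F : I -> fps) P :
  fps_has_prod F P -> fps_prod F = P.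
Proof. by move=> FP; apply: xget_unique => // Q /fps_has_prod_unique; apply. Qed.


Definition zero_one N (A : 'M[nat]_N) : Prop :=
  forall i j, A i j = 0%N \/ A i j = 1%N.

Definition irreducible_mx N (A : 'M[nat]_N) : Prop :=
  forall i j, exists2 n, (0 < n)%N & (0 < (A ^+ n) i j)%N.

Definition edge N (A : 'M[nat]_N) : rel 'I_N := fun i j => A i j == 1%N.

(* [i :: rcons w i] is an admissible word that meets [i] only at its ends. *)
Definition simple_loop N (A : 'M[nat]_N) (i : 'I_N) (w : seq 'I_N) : bool :=
  path (edge A) i (rcons w i) && (i \notin w).

(* Condition (I) of Cuntz and Krieger: every state leads to a state at which
   two different words return for the first time. *)
Definition condition_I N (A : 'M[nat]_N) : Prop :=
  forall i, exists j, exists w1 w2,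
    [/\ connect (edge A) i j, w1 != w2, simple_loop A j w1 & simple_loop A j w2].


(* The coordinate [x n] stands for the coordinate usually numbered [n + 1]. *)
Definition oneX N (A : 'M[nat]_N) :
    set (prod_topology (fun _ : nat => discrete_topology 'I_N)) :=
  [set x | forall n, A (x n) (x n.+1) = 1%N].

Lemma oneX_shift N (A : 'M[nat]_N) (x : oneX A) :
  (fun n => val x n.+1) \in oneX A.
Proof. by apply/mem_set => n; exact: (set_valP x n.+1). Qed.

Definition sigma N (A : 'M[nat]_N) (x : oneX A) : oneX A :=
  exist (fun y => y \in oneX A) _ (oneX_shift x).

Definition twoX N (A : 'M[nat]_N) :
    set (prod_topology (fun _ : int => discrete_topology 'I_N)) :=
  [set x | forall n : int, A (x n) (x (n + 1)) = 1%N].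

Lemma twoX_shift N (A : 'M[nat]_N) (x : twoX A) :
  (fun n : int => val x (n + 1)) \in twoX A.
Proof. by apply/mem_set => n; exact: (set_valP x (n + 1)). Qed.

Definition sigma2 N (A : 'M[nat]_N) (x : twoX A) : twoX A :=
  exist (fun y => y \in twoX A) _ (twoX_shift x).

Lemma twoX_proj N (A : 'M[nat]_N) (x : twoX A) :
  (fun n : nat => val x n.+1%:Z) \in oneX A.
Proof.
by apply/mem_set => n; rewrite -[n.+2]addn1 PoszD; exact: (set_valP x n.+1%:Z).
Qed.

Definition piX N (A : 'M[nat]_N) (x : twoX A) : oneX A :=
  exist (fun y => y \in oneX A) _ (twoX_proj x).

Definition Per N (A : 'M[nat]_N) (n : nat) : set (twoX A) :=
  [set x | iter n (@sigma2 N A) x = x].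
Arguments Per {N} A n.

(* The two disjuncts give the forward and the backward iterates. *)
Definition orbit2 N (A : 'M[nat]_N) (x : twoX A) : set (twoX A) :=
  [set y | exists n, iter n (@sigma2 N A) x = y \/ iter n (@sigma2 N A) y = x].

Definition P_orb N (A : 'M[nat]_N) : set (set (twoX A)) :=
  [set gamma | finite_set gamma /\ exists x, gamma = orbit2 x].
Arguments P_orb {N} A.


Definition homeo_inverse (X Y : topologicalType) (h : X -> Y) (g : Y -> X) :=
  [/\ continuous h, continuous g, cancel h g & cancel g h].

Definition orbit_cocycle N M (A : 'M[nat]_N) (B : 'M[nat]_M)
    (h : oneX A -> oneX B) (k l : oneX A -> nat) : Prop :=
  forall x, iter (k x) (@sigma M B) (h (sigma x)) = iter (l x) (@sigma M B) (h x).


Definition zeta N (A : 'M[nat]_N) : fps :=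
  fps_exp (Fps (fun n =>
    if n == 0%N then 0 else #|` fset_set (Per A n)|%:R / n%:R)).

Definition beta N (A : 'M[nat]_N) (gamma : set (twoX A)) (f : oneX A -> int) : int :=
  \sum_(x \in gamma) f (piX x).

(* The exponent of [t] is meant to be positive; see [zeta_cocycle_defined]. *)
Definition zeta_factor N (A : 'M[nat]_N) (f : oneX A -> int) (gamma : P_orb A) : fps :=
  (1 - fpsX ^+ `|beta (val gamma) f|%N)^-1.

Definition zeta_cocycle_defined N (A : 'M[nat]_N) (f : oneX A -> int) : Prop :=
  (forall gamma, P_orb A gamma -> 0 < beta gamma f) /\
  fps_multipliable (zeta_factor f).

Definition zeta_cocycle N (A : 'M[nat]_N) (f : oneX A -> int) : fps :=
  fps_prod (zeta_factor f).

(* Main.v *)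
Require Import Defs.
From HB Require Import structures.
From mathcomp Require Import all_boot all_order all_algebra finmap zify ring.
From mathcomp Require Import all_classical topology.
Set Implicit Arguments.
Unset Strict Implicit.
Unset Printing Implicit Defensive.
Import Order.TTheory GRing.Theory Num.Theory.
Local Open Scope classical_set_scope.
Local Open Scope ring_scope.

(* Extend the cocycle [c1 = l1 - k1] to the arrows [(u, n, v)], with
   [sigma^k u = sigma^l v] and [n = k - l], of the groupoid of the shift; its value
   there is a lag between [h u] and [h v] in the same sense.  Aperiodic points are
   dense by condition (I), the lag between two tail-equivalent aperiodic points
   is unique, and everything is locally constant: so the extensions of [c1] and
   [c2] are inverse to each other, also at periodic points.  Hence a periodic
   point [x] of least period [p] is sent by [h] to an eventually periodic point
   whose least period is, up to sign, the sum of [c1] over the orbit of [x].  The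
   sign is positive: otherwise the points near [h x] would all be attracted by
   the orbit of [h x] under the expanding map [sigma].  So [h] induces a bijection
   [gamma |-> delta] of the periodic orbits with [beta_gamma c1 = |delta|], and
   the claim is the Euler product of [zeta B], which is checked by comparing
   logarithmic derivatives. *)

(** * Formal power series and Euler products *)

(** The Euler operator [t d/dt]. It preserves degrees, so logarithmic derivatives are compared
    without a shift of coefficients. *)
Definition fps_theta (f : fps) : fps := Fps (fun n => n%:R * f n).

Lemma fps_thetaD f g : fps_theta (f + g) = fps_theta f + fps_theta g.
Proof. by apply: fpsP => n; rewrite /= mulrDr. Qed.

Lemma fps_thetaM f g : fps_theta (f * g) = fps_theta f * g + f * fps_theta g.
Proof.
apply: fpsP => n; rewrite fpsDE !fpsME [LHS]/= mulr_sumr -big_split /=.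
apply: eq_bigr => -[i /=]; rewrite ltnS => lei _.
by rewrite -[in n%:R](subnKC lei) natrD; ring.
Qed.

Lemma fps_theta_const a : fps_theta (fpsC a) = 0.
Proof. by apply: fpsP => -[|n]; rewrite fps0E /= ?mul0r ?mulr0. Qed.

Lemma fps_thetaX f k : fps_theta (f ^+ k.+1) = f ^+ k * fps_theta f *+ k.+1.
Proof.
elim: k => [|k IHk]; first by rewrite !expr1 mul1r.
by rewrite exprS fps_thetaM IHk -mulr_natr -[in RHS]mulr_natr -[k.+2]addn1
  natrD exprS; ring.
Qed.

Lemma fps_theta_prod (I : Type) (r : seq I) (F U : I -> fps) :
  (forall i, fps_theta (F i) = U i * F i) ->
  fps_theta (\prod_(i <- r) F i) = (\sum_(i <- r) U i) * \prod_(i <- r) F i.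
Proof.
move=> FU; elim: r => [|i r IHr].
  by rewrite !big_nil mul0r fps_theta_const.
by rewrite !big_cons fps_thetaM IHr FU; ring.
Qed.

(** As [u] has no constant term, the equation for [f] gives each coefficient from earlier ones and
    from [u] up to the same degree. Since only degrees up to [n] matter, a finite product can be
    compared with a full series. *)
Lemma fps_eq_of_theta (f g u v : fps) n :
  f 0%N = g 0%N -> fps_theta f = u * f -> fps_theta g = v * g ->
  u 0%N = 0 -> (forall i, (i <= n)%N -> u i = v i) -> f n = g n.
Proof.
move=> fg0 fu gv u0 uv; have v0 : v 0%N = 0 by rewrite -uv.
elim/ltn_ind: n uv => -[|n] IHn uv //.
have n0 : n.+1%:R != 0 :> rat by rewrite pnatr_eq0.
apply: (mulfI n0); move/(congr1 (fun h : fps => h n.+1)): fu => /= ->.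
move/(congr1 (fun h : fps => h n.+1)): gv => /= ->.
rewrite big_ord_recl [in RHS]big_ord_recl u0 v0 !mul0r; congr (_ + _).
apply: eq_bigr => i _; rewrite uv; last exact: (ltn_ord (lift ord0 i)).
congr (_ * _); have lti : ((n.+1 - lift ord0 i)%N < n.+1)%N.
  by rewrite /= /bump /=; lia.
by apply: IHn => // j lej; apply: uv; exact: leq_trans lej (ltnW lti).
Qed.

Lemma fps_adic_sumE (F : nat -> fps) m n :
  (forall k i, (i < k)%N -> F k i = 0) -> (n <= m)%N ->
  fps_adic_sum F n = (\sum_(k < m.+1) F k) n.
Proof.
move=> F0 lenm; rewrite /= !fps_sumE (big_ord_widen m.+1 (fun k => F k n)) //.
rewrite big_mkcond; apply: eq_bigr => k _; rewrite ltnS.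
by case: leqP => // nk; rewrite F0.
Qed.

Lemma natr_fps k : k%:R = fpsC k%:R.
Proof.
elim: k => [|k IHk]; first exact: fpsP.
rewrite -addn1 natrD IHk natrD; apply: fpsP => -[|n]; rewrite fpsDE /= //.
Qed.

Lemma fps_unitE (f : fps) : (f \is a GRing.unit) = (f 0%N != 0).
Proof. by []. Qed.

Lemma fps_nat_unit k : (0 < k)%N -> (k%:R : fps) \is a GRing.unit.
Proof. by move=> k0; rewrite natr_fps fps_unitE /= pnatr_eq0 -lt0n. Qed.

Lemma fps_natV k : (0 < k)%N -> (k%:R : fps)^-1 = fpsC (k%:R)^-1.
Proof.
move=> k0; apply: (mulIr (fps_nat_unit k0)); rewrite mulVr ?fps_nat_unit //.
rewrite [in RHS]natr_fps; apply: fpsP => n; rewrite fpsCM fps1E /=.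
by case: n => [|n] /=; rewrite ?mulr0 // mulVf // pnatr_eq0 -lt0n.
Qed.

Lemma fps_exp0 (g : fps) : fps_exp g 0%N = 1.
Proof. by rewrite /= big_ord1 invr1 mul1r. Qed.

(** Termwise, [fps_theta] turns [g^(k+1) / (k+1)!] into [fps_theta g] times [g^k / k!]. *)
Lemma fps_exp_theta (g : fps) :
  g 0%N = 0 -> fps_theta (fps_exp g) = fps_theta g * fps_exp g.
Proof.
move=> g0; pose F k : fps := (k`!)%:R^-1 * g ^+ k.
have factE k : (k`!%:R : fps)^-1 = fpsC (k`!%:R)^-1 by rewrite fps_natV ?fact_gt0.
have F0 k i : (i < k)%N -> F k i = 0.
  by move=> ik; rewrite /F factE fpsCM fpsX_lt ?mulr0.
have thF k : fps_theta (F k.+1) = fps_theta g * F k.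
  have [u1 u2] := (fps_nat_unit (ltn0Sn k), fps_nat_unit (fact_gt0 k)).
  have thc : fps_theta ((k.+1)`!%:R : fps)^-1 = 0 by rewrite factE fps_theta_const.
  rewrite /F fps_thetaM thc mul0r add0r fps_thetaX -[X in _ * X = _]mulr_natr.
  rewrite factS natrM invrM // [_ * k.+1%:R]mulrC mulrA divrK //; ring.
have th_sum (r : seq nat) : fps_theta (\sum_(k <- r) F k) = \sum_(k <- r) fps_theta (F k).
  by elim: r => [|k r IHr]; rewrite ?big_nil ?fps_theta_const // !big_cons fps_thetaD IHr.
apply: fpsP => -[|n]; first by rewrite fpsME big_ord1 /= g0 mulr0 !mul0r.
(* In degree [n.+1] the partial sum suffices. Applying [fps_theta] loses one term, which does no
   harm because [fps_theta g] has no constant term. *)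
transitivity (fps_theta (\sum_(k < n.+2) F k) n.+1).
  by rewrite [RHS]/= -(fps_adic_sumE F0 (leqnn _)).
rewrite -(big_mkord predT F) th_sum big_mkord big_ord_recl.
have -> : fps_theta (F 0%N) = 0 by rewrite /F expr0 mulr1 factE fps_theta_const.
rewrite add0r; under eq_bigr => i _ do rewrite (thF i).
rewrite -mulr_sumr !fpsME big_ord_recl [in RHS]big_ord_recl [fps_theta g _]/= mul0r.
rewrite ![0 * _]mul0r; congr (_ + _); apply: eq_bigr => i _; congr (_ * _).
rewrite (fps_adic_sumE F0 (m := n)) // /= /bump /= add1n subSS leq_subr //.
Qed.

Lemma coef_fpsXn k n : (fpsX ^+ k) n = (n == k)%:R.
Proof.
elim: k n => [|k IHk] n; first by rewrite expr0 fps1E.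
rewrite exprS; case: n => [|n]; first by rewrite fpsME big_ord1 mul0r.
rewrite fpsME big_ord_recl mul0r add0r big_ord_recl /= mul1r IHk big1 ?addr0.
  by rewrite /bump /= subSS subn0.
by move=> i _; rewrite /= mul0r.
Qed.

Lemma coef_fpsMXn (f : fps) k n :
  (f * fpsX ^+ k) n = if (n < k)%N then 0 else f (n - k)%N.
Proof.
rewrite mulrC fpsME; case: ltnP => [nk|kn].
  rewrite big1 // => -[i /= lti] _; rewrite coef_fpsXn.
  by rewrite (_ : (i == k) = false) ?mul0r //; apply/eqP; lia.
have ltk : (k < n.+1)%N by [].
rewrite (bigD1 (Ordinal ltk)) //= coef_fpsXn eqxx mul1r big1 ?addr0 //.
by move=> i ik; rewrite coef_fpsXn (negPf (_ : val i != k)) ?mul0r.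
Qed.

Lemma fps_theta_Xn k : fps_theta (fpsX ^+ k) = fpsX ^+ k *+ k.
Proof.
apply: fpsP => n; rewrite -[in RHS]mulr_natl natr_fps fpsCM /= coef_fpsXn.
by case: eqP => [->|_]; rewrite ?mulr0.
Qed.

Lemma unit_geom k : (0 < k)%N -> (1 - fpsX ^+ k : fps) \is a GRing.unit.
Proof. by case: k => // k _; rewrite fps_unitE fpsDE fpsNE coef_fpsXn subr0. Qed.

Lemma coef_geom k n : (0 < k)%N -> ((1 - fpsX ^+ k)^-1 : fps) n = (k %| n)%:R.
Proof.
move=> k0; pose g := Fps (fun n => (k %| n)%:R); rewrite (_ : _^-1 = g) //.
have u := unit_geom k0.
apply: (mulIr u); rewrite mulVr //; apply: fpsP => m.
rewrite mulrBr mulr1 fpsDE fpsNE coef_fpsMXn fps1E /=; case: ltnP => mk.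
  rewrite oppr0 addr0; case: m mk => [|m] mk; first by rewrite dvdn0.
  by rewrite gtnNdvd.
rewrite dvdn_subl // subrr; case: m mk => //; lia.
Qed.

(** Applying [fps_theta] to [(1 - t^k)^-1 * (1 - t^k) = 1] gives the logarithmic derivative
    [k t^k / (1 - t^k)], here expanded into coefficients. *)
Lemma fps_theta_geom k : (0 < k)%N ->
  fps_theta (1 - fpsX ^+ k)^-1 =
  Fps (fun n => if (0 < n)%N && (k %| n)%N then k%:R else 0) * (1 - fpsX ^+ k)^-1.
Proof.
move=> k0; set F : fps := _^-1.
have u := unit_geom k0.
have -> : Fps (fun n => if (0 < n)%N && (k %| n)%N then k%:R else 0) =
    F * fpsX ^+ k *+ k.
  apply: fpsP => n; rewrite -[in RHS]mulr_natl natr_fps fpsCM coef_fpsMXn [LHS]/=.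
  case: (ltnP n k) => nk.
    case: n nk => [|n] nk /=; first by rewrite mulr0.
    by rewrite gtnNdvd // mulr0.
  rewrite coef_geom // dvdn_subl // (leq_trans k0 nk).
  by case: (k %| n)%N; rewrite ?mulr1 ?mulr0.
have /eqP : fps_theta (F * (1 - fpsX ^+ k)) = 0 by rewrite mulVr // fps_theta_const.
rewrite fps_thetaM [1 - _]addrC fps_thetaD fps_theta_const addr0.
have -> : fps_theta (- fpsX ^+ k) = - (fpsX ^+ k *+ k).
  by rewrite -fps_theta_Xn; apply: fpsP => n; rewrite fpsNE /= mulrN.
rewrite mulrN subr_eq0 [- _ + 1]addrC => /eqP thF.
by rewrite -[LHS](divrK u) mulrAC thF mulrnAr.
Qed.

(** Both sides have constant term 1, and the logarithmic derivative of the exponential has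
    coefficients [c n]. A factor of weight [w i] contributes [w i] in each positive degree divisible
    by [w i], so a large finite product matches them. *)
Lemma euler_product (I : choiceType) (w : I -> nat) (c : nat -> nat) :
  (forall i, (0 < w i)%N) ->
  (forall n, (0 < n)%N -> exists S0 : {fset I}, forall S : {fset I},
     (S0 `<=` S)%fset -> (\sum_(i <- S | (w i %| n)%N) w i)%N = c n) ->
  fps_has_prod (fun i => (1 - fpsX ^+ w i)^-1)
    (fps_exp (Fps (fun n => if n == 0%N then 0 else (c n)%:R / n%:R))).
Proof.
move=> w0 cE n; set g := Fps _.
(* A single finite set has to serve for all degrees up to [n], because [fps_eq_of_theta] compares
   all of them. *)
have [T TE] : exists T : {fset I}, forall S : {fset I}, (T `<=` S)%fset ->
    forall m, (0 < m <= n)%N -> (\sum_(i <- S | (w i %| m)%N) w i)%N = c m.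
  elim: n {g} => [|n [T TE]]; first by exists fset0 => S _ [|m].
  have [S0 S0E] := cE n.+1 isT; exists (T `|` S0)%fset => S /fsubUsetP[TS S0S] m.
  move=> /andP[m0]; rewrite leq_eqVlt => /predU1P[->|lem]; first exact: S0E.
  by apply: TE; rewrite // m0.
exists T => S TS.
pose U i := Fps (fun n => if (0 < n)%N && (w i %| n)%N then (w i)%:R else 0).
apply: (@fps_eq_of_theta _ _ (\sum_(i <- S) U i) (fps_theta g)).
- rewrite fps_exp0; elim/big_rec: _ => // i f _ IHf.
  by rewrite fpsME big_ord1 IHf coef_geom // dvdn0 mulr1.
- by apply: fps_theta_prod => i; apply: fps_theta_geom.
- exact: fps_exp_theta.
- by rewrite fps_sumE big1.
move=> [|m] lem; first by rewrite fps_sumE big1 // /= mul0r.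
rewrite fps_sumE /= mulrC divfK ?pnatr_eq0 // -(TE S) // natr_sum.
by rewrite [RHS]big_mkcond.
Qed.

Lemma fps_has_prod_reindex (I J : choiceType) (e : I -> J) (G : J -> fps) P :
  bijective e -> fps_has_prod G P -> fps_has_prod (G \o e) P.
Proof.
move=> [d eK dK] GP n; have [S0 S0P] := GP n.
exists [fset d j | j in S0]%fset => S dS.
rewrite -(S0P [fset e i | i in S]%fset); last first.
  apply/fsubsetP => j jS; apply/imfsetP; exists (d j); rewrite ?dK //.
  by apply: (fsubsetP dS); apply/imfsetP; exists j.
rewrite big_imfset //=; exact: in2W (can_inj eK).
Qed.

(** * Cylinders and lags *)

Definition agree (T : Type) (m : nat) (x y : nat -> T) :=
  forall i, (i < m)%N -> x i = y i.

Lemma agree_leq T m n (x y : nat -> T) : (m <= n)%N -> agree n x y -> agree m x y.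
Proof. by move=> mn xy i im; apply: xy; apply: leq_trans mn. Qed.

Definition locally_constant N (A : 'M[nat]_N) (T : Type) (f : oneX A -> T) :=
  forall x : oneX A, exists m, forall y : oneX A, agree m (val x) (val y) -> f y = f x.

Definition cyl_continuous N M (A : 'M[nat]_N) (B : 'M[nat]_M) (h : oneX A -> oneX B) :=
  forall (x : oneX A) r, exists m, forall y : oneX A,
    agree m (val x) (val y) -> agree r (val (h x)) (val (h y)).

Lemma nbhs_cylinderP N (A : 'M[nat]_N) (x : oneX A) (U : set (oneX A)) :
  nbhs x U <-> exists m, forall y : oneX A, agree m (val x) (val y) -> U y.
Proof.
split.
  rewrite nbhsE => -[_ [[V Vop <-] Vx] sub].
  (* The cylinders around [x] generate a filter converging to [x] coordinatewise, hence in the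
     product topology; so the open set [V] contains one of them. *)
  pose F := filter_from [set: nat]
    (fun m => [set y : nat -> discrete_topology 'I_N | agree m (val x) y]).
  have FF : Filter F.
    apply: filter_from_filter; first by exists 0%N.
    move=> i j _ _; exists (maxn i j) => // y xy.
    by split; apply: agree_leq xy; rewrite ?leq_maxl ?leq_maxr.
  have : {ptws, F --> (val x : nat -> discrete_topology 'I_N)}.
    apply/pointwise_cvgP => t W /principal_filterP Wt.
    by exists t.+1 => // y /= /(_ t (ltnSn t)) <-.
  have nV : nbhs (val x : prod_topology (fun=> discrete_topology 'I_N)) V.
    by apply: open_nbhs_nbhs.
  by move=> /(_ _ nV)[m _ mV]; exists m => y /mV /sub.
move=> [m mU]; have {mU}: [set y : oneX A | agree m (val x) (val y)] `<=` U by [].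
move/filterS; apply; elim: m => [|m IHm].
  by apply: filterS filterT => y _ i.
have pc : continuous (fun y : oneX A => val y m : discrete_topology 'I_N).
  move=> y; apply: (@continuous_comp _ _ _ (set_val : oneX A -> _) (proj m)).
    exact: initial_continuous.
  exact: proj_continuous.
have: nbhs x [set y : oneX A | val x m = val y m].
  exact: (pc x [set c | val x m = c]).
move: IHm; apply: filterS2 => y /= xy xym i; rewrite ltnS leq_eqVlt => /predU1P[->|] //.
exact: xy.
Qed.

Lemma continuous_nat_locally_constant N (A : 'M[nat]_N) (f : oneX A -> nat) :
  continuous f -> locally_constant f.
Proof.
move=> fc x; have /nbhs_cylinderP[m mP] : nbhs x (f @^-1` [set f x]).
  by apply: fc; apply/principal_filterP.
by exists m => y /mP.
Qed.

Lemma continuous_cyl N M (A : 'M[nat]_N) (B : 'M[nat]_M) (h : oneX A -> oneX B) :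
  continuous h -> cyl_continuous h.
Proof.
move=> hc x r.
have /nbhs_cylinderP[m mP] : nbhs x (h @^-1` [set y | agree r (val (h x)) (val y)]).
  by apply: hc; apply/nbhs_cylinderP; exists r.
by exists m => y /mP.
Qed.

Lemma val_iter_sigma N (A : 'M[nat]_N) (x : oneX A) n i :
  val (iter n (@sigma N A) x) i = val x (n + i)%N.
Proof. by elim: n i => [|n IHn] i //=; rewrite IHn addnS. Qed.

Lemma oneX_ext N (A : 'M[nat]_N) (x y : oneX A) : val x =1 val y -> x = y.
Proof. by move=> xy; apply: val_inj; apply/funext. Qed.

Lemma cyl_continuous_iter N (A : 'M[nat]_N) n : cyl_continuous (iter n (@sigma N A)).
Proof.
move=> x r; exists (n + r)%N => y xy i ir; rewrite !val_iter_sigma.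
by apply: xy; rewrite ltn_add2l.
Qed.

Lemma locally_constant_comp N M (A : 'M[nat]_N) (B : 'M[nat]_M) T
    (f : oneX B -> T) (h : oneX A -> oneX B) :
  locally_constant f -> cyl_continuous h -> locally_constant (f \o h).
Proof.
move=> fc hc x; have [r rP] := fc (h x); have [m mP] := hc x r.
by exists m => y /mP /rP.
Qed.

Lemma locally_constant2 N (A : 'M[nat]_N) T1 T2 T (op : T1 -> T2 -> T) f g :
  @locally_constant N A T1 f -> @locally_constant N A T2 g ->
  locally_constant (fun x => op (f x) (g x)).
Proof.
move=> fc gc x; have [m mP] := fc x; have [n nP] := gc x.
exists (maxn m n) => y xy; rewrite mP ?nP //; apply: agree_leq xy.
  exact: leq_maxr.
exact: leq_maxl.
Qed.

(** Values in any [nmodType], so that the same sums serve for exponents in [nat] and for cocycles in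
    [int]. *)
Definition birkhoff N (A : 'M[nat]_N) (V : nmodType) (f : oneX A -> V) n x : V :=
  \sum_(i < n) f (iter i (@sigma N A) x).

Lemma birkhoffS N (A : 'M[nat]_N) (V : nmodType) (f : oneX A -> V) n x :
  birkhoff f n.+1 x = birkhoff f n x + f (iter n (@sigma N A) x).
Proof. exact: big_ord_recr. Qed.

Lemma birkhoff_natS N (A : 'M[nat]_N) (f : oneX A -> nat) n x :
  birkhoff f n.+1 x = (birkhoff f n x + f (iter n (@sigma N A) x))%N.
Proof. exact: birkhoffS. Qed.

Lemma birkhoffD N (A : 'M[nat]_N) (V : nmodType) (f : oneX A -> V) m n x :
  birkhoff f (m + n) x = birkhoff f m x + birkhoff f n (iter m (@sigma N A) x).
Proof.
elim: n => [|n IHn]; first by rewrite addn0 /birkhoff big_ord0 addr0.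
by rewrite addnS !birkhoffS IHn addrA -iterD addnC.
Qed.

Lemma birkhoff_period N (A : 'M[nat]_N) (V : nmodType) (f : oneX A -> V) p q x :
  iter p (@sigma N A) x = x -> birkhoff f (q * p) x = birkhoff f p x *+ q.
Proof.
move=> xp; elim: q => [|q IHq]; first by rewrite /birkhoff big_ord0.
by rewrite mulSn birkhoffD xp IHq mulrS.
Qed.

Lemma locally_constant_birkhoff N (A : 'M[nat]_N) (V : nmodType) (f : oneX A -> V) n :
  locally_constant f -> locally_constant (birkhoff f n).
Proof.
move=> fc; elim: n => [|n IHn].
  by move=> x; exists 0%N => y _; rewrite /birkhoff !big_ord0.
have := locally_constant2 +%R IHn (locally_constant_comp fc (@cyl_continuous_iter _ A n)).
by move=> H x; have [m mP] := H x; exists m => y /mP; rewrite !birkhoffS.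
Qed.

(* [lag u n v] says that [(u, n, v)] is an arrow of the Deaconu-Renault groupoid
   of the shift. *)
Definition lag N (A : 'M[nat]_N) (u : oneX A) (n : int) (v : oneX A) :=
  exists k l, iter k (@sigma N A) u = iter l (@sigma N A) v /\ n = k%:Z - l%:Z.

Lemma lag_sym N (A : 'M[nat]_N) (u v : oneX A) n : lag u n v -> lag v (- n) u.
Proof. by move=> [k [l [kl ->]]]; exists l, k; split=> //; rewrite opprB. Qed.

Lemma lag_trans N (A : 'M[nat]_N) (u v w : oneX A) m n :
  lag u m v -> lag v n w -> lag u (m + n) w.
Proof.
move=> [k [l [kl ->]]] [k' [l' [kl' ->]]]; exists (k + k')%N, (l + l')%N; split; last lia.
by rewrite addnC iterD kl -iterD addnC iterD kl' -iterD.
Qed.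

Lemma lag_iter N (A : 'M[nat]_N) (u : oneX A) n : lag u n%:Z (iter n (@sigma N A) u).
Proof. by exists n, 0%N; rewrite subr0. Qed.

(** A nonzero lag from [u] to itself means eventual periodicity, so these are the points with
    trivial isotropy in the groupoid. *)
Definition aperiodic N (A : 'M[nat]_N) (u : oneX A) := forall n, lag u n u -> n = 0.

Lemma aperiodic_lag N (A : 'M[nat]_N) (u v : oneX A) m n :
  aperiodic u -> lag u m v -> lag u n v -> m = n.
Proof.
move=> ap um /lag_sym un; apply/eqP; rewrite -subr_eq0; apply/eqP/ap.
exact: lag_trans um un.
Qed.

(** On a periodic orbit the shift is invertible: [l * p - l] further steps undo the [l] extra steps
    on both sides of the lag. *)
Lemma lag_periodic N (A : 'M[nat]_N) (u : oneX A) p (n : nat) :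
  (0 < p)%N -> iter p (@sigma N A) u = u -> lag u n%:Z u -> iter n (@sigma N A) u = u.
Proof.
move=> p0 up [k [l [kl nE]]]; have {nE} kE : k = (n + l)%N by lia.
have upq q : iter (q * p) (@sigma N A) u = u.
  by elim: q => [|q IHq] //; rewrite mulSn iterD IHq.
have ul : iter (l * p - l + l) (@sigma N A) u = u by rewrite subnK ?upq // leq_pmulr.
by rewrite -[in LHS]ul -iterD addnCA iterD -kE kl -iterD ul.
Qed.

Section Cocycle.
Variables (N M : nat) (A : 'M[nat]_N) (B : 'M[nat]_M).
Variables (h : oneX A -> oneX B) (k l : oneX A -> nat).
Hypothesis kl_cocycle : orbit_cocycle h k l.

(** Powers of the shift commute, so the exponents of successive steps add up on each side. *)
Lemma orbit_cocycle_iter n x :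
  iter (birkhoff k n x) (@sigma M B) (h (iter n (@sigma N A) x)) =
  iter (birkhoff l n x) (@sigma M B) (h x).
Proof.
elim: n => [|n IHn]; first by rewrite /birkhoff !big_ord0.
rewrite !birkhoff_natS /= iterD kl_cocycle -iterD addnC iterD IHn.
by rewrite -iterD addnC.
Qed.

Lemma orbit_cocycle_lag n x :
  lag (h x) (birkhoff (fun z => (l z)%:Z - (k z)%:Z) n x) (h (iter n (@sigma N A) x)).
Proof.
exists (birkhoff l n x), (birkhoff k n x); split; first by rewrite orbit_cocycle_iter.
elim: n => [|n IHn]; first by rewrite /birkhoff !big_ord0.
by rewrite !birkhoff_natS birkhoffS IHn; lia.
Qed.

Lemma orbit_cocycle_tail u v n : lag u n v -> exists m, lag (h u) m (h v).
Proof.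
move=> [a [b [ab _]]].
have := orbit_cocycle_lag a u; rewrite ab => /lag_trans H.
by have /lag_sym/H := orbit_cocycle_lag b v; eexists; eassumption.
Qed.

End Cocycle.

(** * Density of aperiodic points *)

Section AperiodicPoints.
Variables (N : nat) (A : 'M[nat]_N).

Lemma oneX_edge (x : oneX A) i : edge A (val x i) (val x i.+1).
Proof. by apply/eqP; exact: (set_valP x i). Qed.

Lemma oneX_cons (a : 'I_N) (x : oneX A) : edge A a (val x 0%N) ->
  exists y : oneX A, val y 0%N = a /\ forall i, val y i.+1 = val x i.
Proof.
move=> ax; pose y n := if n is m.+1 then val x m else a.
have yP : y \in oneX A by apply/mem_set => -[|n]; apply/eqP => //=; exact: oneX_edge.
by exists (exist _ y yP).
Qed.

Lemma oneX_prepend (s : seq 'I_N) (x : oneX A) : sorted (edge A) (rcons s (val x 0%N)) ->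
  exists y : oneX A, (forall i, (i < size s)%N -> val y i = nth (val x 0%N) s i) /\
    forall i, val y (size s + i)%N = val x i.
Proof.
elim: s => [|a s IHs] /=; first by exists x.
move=> as_; have [y [ys yx]] := IHs (path_sorted as_).
have ay : edge A a (val y 0%N).
  case: s as_ ys yx {IHs} => [|b s] /= /andP[ab _] ys yx; first by rewrite (yx 0%N).
  by rewrite ys.
have [z [z0 zS]] := oneX_cons ay.
exists z; split=> [[|i] //=|i]; first by rewrite zS; apply: ys.
by rewrite addSn zS yx.
Qed.

Lemma sorted_take_oneX (x : oneX A) n : sorted (edge A) (mkseq (val x) n).
Proof.
apply/(sortedP (val x 0%N)) => i; rewrite size_mkseq => ni.
by rewrite !nth_mkseq // ?oneX_edge // ltnW.
Qed.

(** As [j] occurs in neither word, its first position after the initial letter is the length of [w1]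
    on one side and of [w2] on the other. *)
Lemma cat_simple_loop_inj j w1 w2 : simple_loop A j w1 -> simple_loop A j w2 ->
  (j :: w1) ++ (j :: w2) = (j :: w2) ++ (j :: w1) -> w1 = w2.
Proof.
move=> /andP[_ jw1] /andP[_ jw2] /= [w12].
have /eqP := congr1 (index j) w12; rewrite !index_cat (negPf jw1) (negPf jw2) /=.
rewrite eqxx !addn0 => /eqP sz; have /eqP := w12.
by rewrite eqseq_cat // => /andP[/eqP].
Qed.

(** A binary sequence selects the blocks to concatenate. All blocks start at [j], so any may follow
    any other, and their equal length makes decoding a division by [P]. *)
Lemma oneX_blocks j P (u : bool -> seq 'I_N) :
  (0 < P)%N -> (forall b, size (u b) = P) -> (forall b, nth j (u b) 0 = j) ->
  (forall b, sorted (edge A) (rcons (u b) j)) -> u true != u false ->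
  exists f : (nat -> bool) -> oneX A, injective f /\ forall s, val (f s) 0%N = j.
Proof.
move=> P0 uP u0 us u12.
pose f (s : nat -> bool) n := nth j (u (s (n %/ P)%N)) (n %% P)%N.
have fP s : f s \in oneX A.
  apply/mem_set => n; apply/eqP; rewrite -/(edge A _ _).
  have nP : (n %% P < P)%N by rewrite ltn_mod.
  have := us (s (n %/ P)%N) => /(sortedP j) /(_ (n %% P)%N).
  rewrite size_rcons uP ltnS nP => /(_ isT); rewrite !nth_rcons !uP nP.
  have -> : f s n.+1 = if ((n %% P).+1 < P)%N then nth j (u (s (n %/ P)%N)) (n %% P).+1 else j.
    rewrite /f (_ : n.+1 = n %/ P * P + (n %% P).+1)%N; last by rewrite addnS -divn_eq.
    rewrite divnMDl // modnMDl; case: ltnP => nP1.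
      by rewrite (divn_small nP1) addn0 (modn_small nP1).
    by rewrite (_ : (n %% P).+1 = P) ?modnn ?u0 //; apply/eqP; rewrite eqn_leq nP.
  by case: ifP => // _; case: ifP.
exists (fun s => exist _ (f s) (fP s)); split=> [s s' /(congr1 val) /= ff|s]; last first.
  by rewrite /= /f div0n mod0n u0.
apply/funext => k; have uss : u (s k) = u (s' k).
  apply: (@eq_from_nth _ j); rewrite ?uP // => i iP.
  have := congr1 (@^~ (k * P + i)%N) ff.
  by rewrite /f divnMDl // modnMDl divn_small // addn0 modn_small.
by case: (s k) (s' k) uss u12 => [] [] // ->; rewrite eqxx.
Qed.

(** From the letter [val v r] a path leads to a state [j] with two different return loops, which can
    then be run through in any order. *)
Lemma cylinder_uncountable (v : oneX A) r : condition_I A ->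
  exists e : (nat -> bool) -> oneX A, injective e /\ forall s, agree r (val v) (val (e s)).
Proof.
move=> cI; have [j [w1 [w2 [/connectP[p ip jE] w12 l1 l2]]]] := cI (val v r).
(* Running both loops in either order gives two blocks of the same length, as [oneX_blocks]
   requires. *)
pose u b := if b then (j :: w1) ++ (j :: w2) else (j :: w2) ++ (j :: w1).
have us b : sorted (edge A) (rcons (u b) j).
  have [/andP[s1 _] /andP[s2 _]] := (l1, l2).
  case: b; rewrite /u rcons_cat /= -cat1s catA cats1 cat_path last_rcons.
    by rewrite s1 s2.
  by rewrite s1 s2.
have uP b : size (u b) = (size w1 + size w2).+2 by case: b; rewrite /= size_cat /=; lia.
have u0 b : nth j (u b) 0 = j by case: b.
have u12 : u true != u false by apply: contra_neq w12; apply: cat_simple_loop_inj.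
have [f [fI f0]] := oneX_blocks (ltn0Sn _) uP u0 us u12.
(* The first [r] letters of [v], then the path from [val v r] to [j] without its last letter, which
   the first block supplies. *)
pose pre := mkseq (val v) r ++ belast (val v r) p.
have preE : rcons pre j = mkseq (val v) r ++ val v r :: p.
  by rewrite /pre -cats1 -catA cats1 jE -lastI.
have sp : sorted (edge A) (rcons pre j).
  rewrite preE -cat_rcons -mkseqS; have := sorted_take_oneX v r.+1.
  by rewrite mkseqS; case: (mkseq _ r) => [|a l] //=; rewrite cat_path last_rcons => ->.
have /choice[e eP] s : exists y : oneX A,
    (forall i, (i < size pre)%N -> val y i = nth (val (f s) 0%N) pre i) /\
    forall i, val y (size pre + i)%N = val (f s) i.
  by apply: oneX_prepend; rewrite f0.
exists e; split=> [s s' ee|s i ir].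
  by apply/fI/oneX_ext => i; rewrite -(eP s).2 ee (eP s').2.
by rewrite (eP s).1 /pre ?size_cat ?nth_cat size_mkseq ?ir ?nth_mkseq // ltn_addr.
Qed.

(** Cantor's diagonal argument: for injective [g], the sequence [d] would differ from every [s] at
    the place [g s], hence also from itself. *)
Lemma no_injection_cantor (g : (nat -> bool) -> nat) : ~ injective g.
Proof.
move=> gI; pose d n := `[< exists2 s, g s = n & s n = false >].
case dn: (d (g d)); last first.
  by move/asboolPn: (negbT dn) => []; exists d.
by have /asboolP[s /gI ->] := dn; rewrite dn.
Qed.

Lemma not_aperiodicE (w : oneX A) : ~ aperiodic w ->
  exists kl : nat * nat, (kl.1 < kl.2)%N /\
    forall i, val w (kl.1 + i)%N = val w (kl.2 + i)%N.
Proof.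
move=> /existsNP[n /not_implyP[[k [l [kl nE]]] n0]].
have {}kl i : val w (k + i)%N = val w (l + i)%N.
  by rewrite -!val_iter_sigma kl.
case: (ltngtP k l) => lt; [by exists (k, l)| |].
  by exists (l, k); split=> //= i; rewrite kl.
by case: n0; rewrite nE lt subrr.
Qed.

(** An eventually periodic point is coded by two positions with equal tails and its letters before
    the second one. Such points are countable, while a cylinder is not. *)
Lemma aperiodic_dense (v : oneX A) r : condition_I A ->
  exists w : oneX A, agree r (val v) (val w) /\ aperiodic w.
Proof.
move=> /(cylinder_uncountable v r)[e [eI ev]]; apply: contrapT => noap.
have /choice[kl klP] s : exists kl : nat * nat, (kl.1 < kl.2)%N /\
    forall i, val (e s) (kl.1 + i)%N = val (e s) (kl.2 + i)%N.
  by apply: not_aperiodicE => ap; apply: noap; exists (e s).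
pose code s : nat * nat * seq 'I_N := (kl s, mkseq (val (e s)) (kl s).2).
case: (@no_injection_cantor (choice.pickle \o code)); apply: inj_comp.
  exact: pcan_inj choice.pickleK.
move=> s s' [kls ms]; apply/eI/oneX_ext; elim/ltn_ind => i IHi.
have [il|li] := ltnP i (kl s).2.
  have := congr1 (fun l => nth (val (e s) 0%N) l i) ms.
  by rewrite !nth_mkseq -?kls.
(* Past the second position, each letter repeats one at a strictly earlier place. *)
have [klt klE] := klP s; have [_] := klP s'; rewrite -kls => klE'.
rewrite -(subnKC li) -klE -klE'; apply: IHi; lia.
Qed.

End AperiodicPoints.

(** * Least periods under an orbit equivalence *)

Section PeriodicPoints.
Variables (N M : nat) (A : 'M[nat]_N) (B : 'M[nat]_M).
Hypotheses (A_I : condition_I A) (B_I : condition_I B).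
Variables (h : oneX A -> oneX B) (hinv : oneX B -> oneX A).
Hypothesis (hK : cancel h hinv) (hinvK : cancel hinv h).
Hypothesis (h_cyl : cyl_continuous h) (hinv_cyl : cyl_continuous hinv).
Variables (k1 l1 : oneX A -> nat) (k2 l2 : oneX B -> nat).
Hypothesis (k1_lc : locally_constant k1) (l1_lc : locally_constant l1).
Hypothesis (k2_lc : locally_constant k2) (l2_lc : locally_constant l2).
Hypothesis (eq1 : orbit_cocycle h k1 l1) (eq2 : orbit_cocycle hinv k2 l2).

Local Notation sA := (@sigma N A).
Local Notation sB := (@sigma M B).
Let c1 (x : oneX A) : int := (l1 x)%:Z - (k1 x)%:Z.
Let c2 (y : oneX B) : int := (l2 y)%:Z - (k2 y)%:Z.

(* Both sides are locally constant in [x], and for aperiodic [x] the lag from [x]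
   to [sigma^p x] is unique. *)
Lemma orbit_cocycle_inverse p x :
  birkhoff c2 (birkhoff l1 p x) (h x) -
  birkhoff c2 (birkhoff k1 p x) (h (iter p sA x)) = p%:Z.
Proof.
set L := birkhoff l1 p x; set K := birkhoff k1 p x.
have c2_lc : locally_constant c2.
  exact: (locally_constant2 (fun a b : nat => a%:Z - b%:Z) l2_lc k2_lc).
have [m mP] := locally_constant2 pair
  (locally_constant_comp (locally_constant_birkhoff L c2_lc) h_cyl)
  (locally_constant_comp (locally_constant_comp (locally_constant_birkhoff K c2_lc) h_cyl)
    (@cyl_continuous_iter _ A p)) x.
(* [L] and [K] are computed at [x]; close to [x] the step counts are the same, so they are correct
   for [z] too. *)
have [n nP] := locally_constant2 pair
  (locally_constant_birkhoff p l1_lc) (locally_constant_birkhoff p k1_lc) x.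
have [z [xz z_ap]] := aperiodic_dense x (maxn m n) A_I.
have [/= <- <-] := mP z (agree_leq (leq_maxl _ _) xz).
have [/= Lz Kz] := nP z (agree_leq (leq_maxr _ _) xz).
have := orbit_cocycle_iter eq1 p z; rewrite Lz Kz -/L -/K => KL.
apply: (aperiodic_lag z_ap _ (lag_iter z p)).
have := orbit_cocycle_lag eq2 L (h z); have := orbit_cocycle_lag eq2 K (h (iter p sA z)).
by rewrite KL !hK => /lag_sym H /lag_trans; apply.
Qed.

(** The point [z'] is [z] preceded by one period of [x]: this is the contracting inverse branch of
    the [p]-th power of the shift at [x]. *)
Lemma periodic_prepend p x z m : (0 < m)%N -> iter p sA x = x -> agree m (val x) (val z) ->
  exists z', iter p sA z' = z /\ agree (p + m) (val x) (val z').
Proof.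
move=> m0 xp xz; have [|z' [z'x z'z]] := @oneX_prepend _ A (mkseq (val x) p) z.
  rewrite -(xz 0%N) // -[in X in rcons _ X]xp val_iter_sigma addn0 -mkseqS.
  exact: sorted_take_oneX.
move: z'x z'z; rewrite size_mkseq => z'x z'z.
exists z'; split=> [|i]; first by apply: oneX_ext => i; rewrite val_iter_sigma.
case: (ltnP i p) => [ip _|pi]; first by rewrite z'x ?nth_mkseq.
by rewrite -(subnKC pi) ltn_add2l -val_iter_sigma xp z'z => /xz.
Qed.

(* If the sum of [c1] along the orbit were negative, then every point of [X_B]
   near [h x] would be attracted to the orbit of [h x] by the shift, hence would be
   eventually periodic. *)
Lemma birkhoff_lt p x : (0 < p)%N -> iter p sA x = x -> (birkhoff k1 p x < birkhoff l1 p x)%N.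
Proof.
move=> p0 xp; have := orbit_cocycle_inverse p x.
set L := birkhoff l1 p x; set K := birkhoff k1 p x; rewrite xp => LKp.
case: (ltngtP K L) => // [LK|KL]; last by move: LKp; rewrite KL subrr; lia.
pose d := (K - L)%N.
have [m mP] := locally_constant2 pair
  (locally_constant_birkhoff p l1_lc) (locally_constant_birkhoff p k1_lc) x.
(* The first [m] letters keep [L] and [K] valid; one more makes the length positive for
   [periodic_prepend]. *)
have [r rP] := hinv_cyl (h x) m.+1.
have [w [hxw w_ap]] := aperiodic_dense (h x) r B_I.
have [z0 z0E xz0] : exists2 z0, h z0 = w & agree m.+1 (val x) (val z0).
  by exists (hinv w); rewrite ?hinvK // -[x in agree _ (val x)]hK; apply: rP.
(* Each pull-back of [z] through a period of [x] brings it [p] letters closer to [x] and, by the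
   cocycle relation, corresponds to [d] more shifts of [w]. *)
have zP n : exists2 z, iter (L + n * d) sB w = iter L sB (h z) &
    agree (n * p + m.+1) (val x) (val z).
  elim: n => [|n [z wz xz]]; first by exists z0; rewrite ?z0E // addn0.
  have [|z' [z'z xz']] := periodic_prepend _ xp xz; first by rewrite addnS.
  exists z'; last by rewrite mulSn -addnA.
  have xz'm : agree m (val x) (val z') by apply: agree_leq xz'; lia.
  have [/= Lz Kz] := mP z' xz'm.
  have := orbit_cocycle_iter eq1 p z'; rewrite Lz Kz -/L -/K z'z => <-.
  rewrite (_ : L + n.+1 * d = d + (L + n * d))%N; last by lia.
  by rewrite iterD wz -iterD subnK // ltnW.
have [q qP] : exists q, forall z, agree q (val x) (val z) ->
    agree d (val (iter L sB (h x))) (val (iter L sB (h z))).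
  have [r' r'P] := @cyl_continuous_iter _ B L (h x) d.
  by have [q qP] := h_cyl x r'; exists q => z /qP /r'P.
have d0 : (0 < d)%N by rewrite subn_gt0.
(* From block [q] on, all blocks of [d] letters of [w] are equal, so [w] is eventually periodic,
   against its choice. *)
have wE n i : (q <= n)%N -> (i < d)%N ->
    val w (L + n * d + i)%N = val (iter L sB (h x)) i.
  move=> qn id; have [z wz xz] := zP n; rewrite -val_iter_sigma wz -(qP z) //.
  by apply: agree_leq xz; rewrite (leq_trans qn) // (leq_trans (leq_pmulr n p0)) // leq_addr.
suff : d%:Z = 0 by lia.
apply: w_ap; exists (d + (L + q * d))%N, (L + q * d)%N; split; last by lia.
apply: oneX_ext => i; rewrite !val_iter_sigma (divn_eq i d).
rewrite (_ : d + (L + q * d) + _ = L + (q + i %/ d).+1 * d + i %% d)%N; last by lia.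
rewrite (_ : (L + q * d) + _ = L + (q + i %/ d) * d + i %% d)%N; last by lia.
by rewrite !wE ?ltn_mod // ?leqW ?leq_addr.
Qed.

Lemma birkhoff_cocycleE p x :
  birkhoff c1 p x = (birkhoff l1 p x)%:Z - (birkhoff k1 p x)%:Z.
Proof.
elim: p => [|p IHp]; first by rewrite /birkhoff !big_ord0.
by rewrite !birkhoff_natS birkhoffS IHp /c1; lia.
Qed.

End PeriodicPoints.

Definition has_minimal_period (T : Type) (s : T -> T) (x : T) (p : nat) :=
  (0 < p)%N /\ forall n, iter n s x = x <-> (p %| n)%N.

Section MinimalPeriod.
Variables (N M : nat) (A : 'M[nat]_N) (B : 'M[nat]_M).
Hypotheses (A_I : condition_I A) (B_I : condition_I B).
Variables (h : oneX A -> oneX B) (hinv : oneX B -> oneX A).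
Hypothesis (hK : cancel h hinv) (hinvK : cancel hinv h).
Hypothesis (h_cyl : cyl_continuous h) (hinv_cyl : cyl_continuous hinv).
Variables (k1 l1 : oneX A -> nat) (k2 l2 : oneX B -> nat).
Hypothesis (k1_lc : locally_constant k1) (l1_lc : locally_constant l1).
Hypothesis (k2_lc : locally_constant k2) (l2_lc : locally_constant l2).
Hypothesis (eq1 : orbit_cocycle h k1 l1) (eq2 : orbit_cocycle hinv k2 l2).

Local Notation sA := (@sigma N A).
Local Notation sB := (@sigma M B).
Let c1 (x : oneX A) : int := (l1 x)%:Z - (k1 x)%:Z.
Let c2 (y : oneX B) : int := (l2 y)%:Z - (k2 y)%:Z.

(** The cocycle relation makes [a = L - K] a period of [y]. A return of [y] after [n] steps is
    carried by [hinv] to a return of [x] after [b] steps, with [b] the sum of [c2]; so [p] divides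
    [b], which forces [a] to divide [n]. *)
Lemma orbit_equivalence_period p x : has_minimal_period sA x p ->
  exists a n, [/\ birkhoff c1 p x = a%:Z & has_minimal_period sB (iter n sB (h x)) a].
Proof.
move=> [p0 xP]; have xp : iter p sA x = x by apply/xP.
have lt1 := birkhoff_lt A_I B_I hK hinvK h_cyl hinv_cyl k1_lc l1_lc k2_lc l2_lc eq1 eq2 p0 xp.
have := orbit_cocycle_inverse A_I hK h_cyl k1_lc l1_lc k2_lc l2_lc eq1 eq2 p x.
have := orbit_cocycle_iter eq1 p x.
move: lt1; have := birkhoff_cocycleE k1 l1 p x; rewrite -/c1.
set L := birkhoff l1 p x; set K := birkhoff k1 p x => c1E KL; rewrite xp => KLx pE.
exists (L - K)%N, K; split; first by rewrite c1E subzn // ltnW.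
set y := iter K sB (h x); set a := (L - K)%N.
have a0 : (0 < a)%N by rewrite subn_gt0.
have LE : L = (K + a)%N by rewrite subnKC // ltnW.
have ya : iter a sB y = y by rewrite -iterD addnC -LE -KLx.
(* In [orbit_cocycle_inverse] both sums now start at [h x], and their difference is the sum over the
   last [a] steps. *)
have c2a : birkhoff c2 a y = p%:Z by rewrite -pE LE birkhoffD addrC addKr.
split=> // n; split=> [yn|/dvdnP[q ->]]; last first.
  by elim: q => [|q IHq] //; rewrite mulSn iterD IHq.
case: (posnP n) => [->|n0]; first exact: dvdn0.
have lt2 := birkhoff_lt B_I A_I hinvK hK hinv_cyl h_cyl k2_lc l2_lc k1_lc l1_lc eq2 eq1 n0 yn.
have := birkhoff_cocycleE k2 l2 n y; rewrite -/c2 subzn; last exact: ltnW.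
set b := (_ - _)%N => bE; have b0 : (0 < b)%N by rewrite subn_gt0.
(* A lag from [x] to [hinv y] conjugates the self-lag [b] of [hinv y] into one of [x]. *)
have /xP/dvdnP[t bt] : iter b sA x = x.
  apply: (lag_periodic p0 xp).
  have := orbit_cocycle_lag eq2 n y; rewrite -/c2 bE yn => yby.
  have := orbit_cocycle_lag eq2 K (h x); rewrite hK -/y => xy.
  by have := lag_trans (lag_trans xy yby) (lag_sym xy); rewrite addrAC subrr add0r.
(* Summing [c2] over [a * n] steps from [y] in two ways gives [p n = b a = t p a]. *)
have := birkhoff_period c2 a yn; rewrite mulnC (birkhoff_period c2 n ya) c2a bE.
rewrite -(mulr_natr p%:Z) -(mulr_natr b%:Z) !natz -!PoszM => -[/eqP]; rewrite bt.
rewrite -mulnA mulnCA eqn_pmul2l // => /eqP ->.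
exact: dvdn_mull.
Qed.

End MinimalPeriod.

(** * Periodic orbits of the two-sided shift *)

Lemma finite_set_inj (T U : Type) (D : set T) (f : T -> U) :
  {in D &, injective f} -> finite_set (f @` D) -> finite_set D.
Proof. by move=> fI; rewrite (eq_finite_set (inj_card_eq fI)). Qed.

Lemma iter_inj (T : Type) (s : T -> T) n : injective s -> injective (iter n s).
Proof. by move=> sI; elim: n => [|n IHn] x y //= /sI /IHn. Qed.

Lemma iter_periodic (T : Type) (s : T -> T) p q x : iter p s x = x -> iter (q * p) s x = x.
Proof. by move=> xp; rewrite iterM; elim: q => //= q ->. Qed.

Lemma has_minimal_period_exists (T : Type) (s : T -> T) p x : (0 < p)%N ->
  iter p s x = x -> exists m, has_minimal_period s x m.
Proof.
move=> p0 xp; have exq : exists q, (0 < q)%N && `[< iter q s x = x >].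
  by exists p; rewrite p0; apply/asboolP.
have [m /andP[m0 /asboolP xm] mmin] := ex_minnP exq.
exists m; split=> // n; split=> [xn|/dvdnP[q ->]]; last exact: iter_periodic.
apply/negbNE/negP => mn.
have : (0 < n %% m)%N && `[< iter (n %% m) s x = x >].
  rewrite lt0n mn; apply/asboolP; rewrite -[RHS]xn [in RHS](divn_eq n m).
  by rewrite addnC iterD iter_periodic.
by move/mmin; rewrite leqNgt ltn_mod m0.
Qed.

Section TwoSided.
Variables (N : nat) (A : 'M[nat]_N).
Local Notation s1 := (@sigma N A).
Local Notation s2 := (@sigma2 N A).

Lemma val_iter_sigma2 (x : twoX A) n i : val (iter n s2 x) i = val x (i + n%:Z).
Proof.
elim: n i => [|n IHn] i; first by rewrite addr0.
by rewrite iterS /= IHn; congr (val x _); lia.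
Qed.

Lemma twoX_ext (x y : twoX A) : val x =1 val y -> x = y.
Proof. by move=> xy; apply: val_inj; apply/funext. Qed.

Lemma sigma2_inj : injective s2.
Proof.
move=> x y xy; apply: twoX_ext => i; rewrite -(subrK 1 i).
exact: (congr1 (fun z : twoX A => val z (i - 1)) xy).
Qed.

Lemma piX_iter n (x : twoX A) : piX (iter n s2 x) = iter n s1 (piX x).
Proof.
apply: oneX_ext => i; rewrite val_iter_sigma /= val_iter_sigma2.
by congr (val x _); lia.
Qed.

(** A large common period moves any coordinate into the positive range, which [piX] retains. *)
Lemma piX_periodic_inj p q (x y : twoX A) : (0 < p)%N -> (0 < q)%N ->
  iter p s2 x = x -> iter q s2 y = y -> piX x = piX y -> x = y.
Proof.
move=> p0 q0 xp yq xy; apply: twoX_ext => i.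
pose m := (`|i|.+1 * (q * p))%N.
have qp0 : (0 < q * p)%N by rewrite muln_gt0 q0.
have im : (`|i| < m)%N by rewrite leq_pmulr.
have <- : val (iter m s2 x) i = val x i by rewrite iter_periodic // iter_periodic.
have <- : val (iter m s2 y) i = val y i.
  by rewrite iter_periodic // mulnC iter_periodic.
rewrite !val_iter_sigma2 (_ : i + m%:Z = (absz (i + m%:Z)).-1.+1%:Z); last lia.
exact: (congr1 (fun z : oneX A => val z _) xy).
Qed.

Lemma piX_periodic_surj p (z : oneX A) : (0 < p)%N -> iter p s1 z = z ->
  exists2 x : twoX A, iter p s2 x = x & piX x = z.
Proof.
move=> p0 zp; have zmod i : val z (i %% p)%N = val z i.
  rewrite [in RHS](divn_eq i p) -[in LHS](iter_periodic (i %/ p) zp).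
  by rewrite val_iter_sigma.
(* [z] is indexed from 0 while [piX] reads from coordinate 1, hence [i - 1]. The remainder is
   nonnegative, so the absolute value changes nothing. *)
pose x (i : int) : discrete_topology (ordinal N) := val z `|((i - 1) %% p)%Z|%N.
have xP : x \in twoX A.
  apply/mem_set => i; rewrite /x; set r := ((i - 1) %% p)%Z.
  have r0 : 0 <= r by apply: modz_ge0; rewrite -lt0n.
  have -> : ((i + 1 - 1) %% p)%Z = ((r + 1) %% p)%Z by rewrite modzDml addrAC.
  rewrite -(gez0_abs r0) -PoszD modz_nat !absz_nat zmod addn1.
  exact: (set_valP z `|r|%N).
exists (exist _ x xP); last first.
  by apply: oneX_ext => i; rewrite /= /x -addn1 PoszD addrK modz_nat absz_nat zmod.
by apply: twoX_ext => i; rewrite val_iter_sigma2 /= /x addrAC modzDr.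
Qed.

Lemma has_minimal_period_piX p (x : twoX A) :
  has_minimal_period s2 x p -> has_minimal_period s1 (piX x) p.
Proof.
move=> [p0 xP]; split=> // n; rewrite -xP; split=> [xn|xn]; last by rewrite -piX_iter xn.
have xp : iter p s2 x = x by apply/xP.
apply: (@piX_periodic_inj p p) => //; last by rewrite piX_iter.
by rewrite -iterD addnC iterD xp.
Qed.

(** The shift is injective, so common steps cancel. This form makes symmetry and transitivity
    immediate. *)
Lemma orbit2P (x y : twoX A) : orbit2 x y <-> exists a b, iter a s2 x = iter b s2 y.
Proof.
split=> [[n [xy|yx]]|[a [b]]]; [by exists n, 0%N|by exists 0%N, n|].
case: (leqP a b) => [ab|/ltnW ba].
  rewrite -(subnKC ab) iterD => /(iter_inj sigma2_inj) xy.
  by exists (b - a)%N; right.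
rewrite -(subnKC ba) iterD => /(iter_inj sigma2_inj) xy.
by exists (a - b)%N; left.
Qed.

Lemma orbit2_refl (x : twoX A) : orbit2 x x.
Proof. by exists 0%N; left. Qed.

Lemma orbit2_sym (x y : twoX A) : orbit2 x y -> orbit2 y x.
Proof. by move=> /orbit2P[a [b xy]]; apply/orbit2P; exists b, a. Qed.

Lemma orbit2_trans (x y z : twoX A) : orbit2 x y -> orbit2 y z -> orbit2 x z.
Proof.
move=> /orbit2P[a [b xy]] /orbit2P[c [d yz]]; apply/orbit2P.
by exists (c + a)%N, (b + d)%N; rewrite iterD xy -iterD addnC iterD yz -iterD.
Qed.

Lemma orbit2_eq (x y : twoX A) : orbit2 x y -> orbit2 x = orbit2 y.
Proof.
move=> xy; apply/seteqP; split=> z; last exact: orbit2_trans.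
exact/orbit2_trans/orbit2_sym.
Qed.

Lemma orbit2_cycle p (x : twoX A) : has_minimal_period s2 x p ->
  let r := mkseq (fun i => iter i s2 x) p in uniq r /\ orbit2 x = [set` r].
Proof.
move=> [p0 xP]; have xp : iter p s2 x = x by apply/xP.
split.
  rewrite map_inj_in_uniq ?iota_uniq // => i j; rewrite !mem_iota /= !add0n => ip jp.
  wlog ij : i j ip jp / (i <= j)%N.
    by move=> H; case: (leqP i j) => [ij|/ltnW ji] ijE; [|symmetry]; apply: H.
  rewrite -(subnKC ij) iterD => /(iter_inj sigma2_inj)/esym/xP.
  case: (posnP (j - i)) => [->|ji]; first by rewrite addn0.
  by move/(dvdn_leq ji); rewrite leqNgt (leq_ltn_trans (leq_subr _ _) jp).
have xmod n : iter (n %% p) s2 x = iter n s2 x.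
  by rewrite [in RHS](divn_eq n p) addnC iterD iter_periodic.
apply/seteqP; split=> y /=; last by move=> /mapP[i _ ->]; exists i; left.
move=> xy; have {xy}[n <-] : exists n, iter n s2 x = y.
  have [n [<-|yx]] := xy; first by exists n.
  (* Going back [n] steps on a [p]-periodic orbit is going forward [n * p - n] steps. *)
  exists (n * p - n)%N; apply: (iter_inj (n := n) sigma2_inj).
  by rewrite yx -iterD subnKC ?iter_periodic // leq_pmulr.
by rewrite -xmod; apply: map_f; rewrite mem_iota ltn_mod.
Qed.

(** In a finite orbit the iterates cannot all be distinct, and injectivity of the shift turns a
    coincidence into a return to the start. *)
Lemma P_orbP (gamma : set (twoX A)) : P_orb A gamma <->
  exists x p, has_minimal_period s2 x p /\ gamma = orbit2 x.
Proof.
split=> [[fin [x gE]]|[x [p [xp ->]]]]; last first.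
  by split; [have [_ ->] := orbit2_cycle xp; exact: finite_seq|exists x].
suff [p p0 xp] : exists2 p, (0 < p)%N & iter p s2 x = x.
  by have [m] := has_minimal_period_exists p0 xp; exists x, m.
apply: contrapT => noper; apply: infinite_nat.
apply: (@finite_set_inj _ _ _ (fun n => iter n s2 x)).
  move=> i j _ _; wlog ij : i j / (i <= j)%N.
    by move=> H; case: (leqP i j) => [ij|/ltnW ji] ijE; [|symmetry]; apply: H.
  rewrite -(subnKC ij) iterD => /(iter_inj sigma2_inj)/esym xji.
  case: (posnP (j - i)) => [->|ji]; first by rewrite addn0.
  by case: noper; exists (j - i)%N.
by apply: sub_finite_set fin => _ [n _ <-]; rewrite gE; exists n; left.
Qed.

Lemma P_orb_in (gamma : set (twoX A)) x : P_orb A gamma -> gamma x ->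
  gamma = orbit2 x /\ exists p, has_minimal_period s2 x p.
Proof.
move=> /P_orbP[y [p [yp ->]]] yx; split; first exact: orbit2_eq.
have [p0 yP] := yp; apply: (@has_minimal_period_exists _ _ p) => //.
have /orbit2P[a [b yxab]] := yx; apply: (iter_inj (n := b) sigma2_inj).
by rewrite -iterD addnC iterD -yxab -iterD addnC iterD; congr iter; apply/yP.
Qed.

Lemma card_orbit2 p (x : twoX A) : has_minimal_period s2 x p ->
  #|` fset_set (orbit2 x)| = p.
Proof.
move=> /orbit2_cycle[ur ->].
have -> : [set` mkseq (fun i => iter i s2 x) p] =
    [set` [fset y in mkseq (fun i => iter i s2 x) p]%fset].
  by apply/seteqP; split=> y /=; rewrite inE.
by rewrite set_fsetK card_fseq undup_id // size_mkseq.
Qed.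

Lemma beta_orbit2 p (x : twoX A) (f : oneX A -> int) : has_minimal_period s2 x p ->
  beta (orbit2 x) f = birkhoff f p (piX x).
Proof.
move=> /orbit2_cycle[ur ->]; rewrite /beta -fsbig_seq // /birkhoff big_map.
by rewrite -(big_mkord predT (fun i => f (iter i s1 (piX x)))) /index_iota subn0;
  apply: eq_bigr => i _; rewrite piX_iter.
Qed.

Lemma finite_Per n : (0 < n)%N -> finite_set (Per A n).
Proof.
move=> n0; apply: (@finite_set_inj _ _ _ (fun x => [ffun i : 'I_n => val (piX x) i : 'I_N])).
  move=> x y /set_mem xn /set_mem yn xy; apply: (piX_periodic_inj n0 n0 xn yn).
  have modE z i : Per A n z -> val (piX z) i = val (piX z) (i %% n)%N.
    move=> zn; rewrite [in LHS](divn_eq i n) -val_iter_sigma -piX_iter.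
    by rewrite iter_periodic.
  apply: oneX_ext => i; rewrite (modE x) // (modE y) //.
  have ni : (i %% n < n)%N by rewrite ltn_mod.
  by have /ffunP/(_ (Ordinal ni)) := xy; rewrite !ffunE.
exact: finite_finset.
Qed.

Lemma P_orb_card_gt0 (gamma : P_orb A) : (0 < #|` fset_set (val gamma)|)%N.
Proof.
by have /P_orbP[x [p [xp ->]]] := set_valP gamma; rewrite (card_orbit2 xp); case: xp.
Qed.

Lemma Per_orbit n x : (0 < n)%N -> Per A n x <->
  P_orb A (orbit2 x) /\ (#|` fset_set (orbit2 x)| %| n)%N.
Proof.
move=> n0; split=> [xn|[orb dv]].
  have [p xp] := has_minimal_period_exists n0 xn; rewrite (card_orbit2 xp).
  by split; [apply/P_orbP; exists x, p|apply/xp.2].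
have [_ [p xp]] := P_orb_in orb (orbit2_refl x).
by apply/xp.2; rewrite -(card_orbit2 xp).
Qed.

(** [Per A n] is the disjoint union of the finitely many orbits whose size divides [n]. This
    supplies the counting hypothesis of [euler_product]. *)
Lemma sum_card_P_orb n : (0 < n)%N -> exists S0 : {fset P_orb A}, forall S : {fset P_orb A},
  (S0 `<=` S)%fset ->
  (\sum_(gamma <- S | (#|` fset_set (val gamma)| %| n)%N) #|` fset_set (val gamma)|)%N =
  #|` fset_set (Per A n)|.
Proof.
move=> n0; pose D := [set gamma : P_orb A | (#|` fset_set (val gamma)| %| n)%N].
have perD (gamma : P_orb A) x : val gamma x -> D gamma <-> Per A n x.
  move=> gx; have [gE _] := P_orb_in (set_valP gamma) gx.
  by rewrite Per_orbit // /D /= gE; split=> [|[]] //; split=> //; rewrite -gE; exact: set_valP.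
have finD : finite_set D.
  apply: (@finite_set_inj _ _ _ val); first by move=> ? ? _ _; exact: val_inj.
  apply: (sub_finite_set _ (finite_image (@orbit2 N A) (finite_Per n0))).
  move=> _ [gamma Dg <-]; have /P_orbP[x [p [_ gE]]] := set_valP gamma.
  by exists x => //; apply/(perD gamma) => //; rewrite gE; exact: orbit2_refl.
exists (fset_set D) => S DS.
have finP (gamma : P_orb A) : finite_set (val gamma) by have [] := set_valP gamma.
pose E := fset_set (Per A n).
rewrite -[RHS]sum1_size.
(* Double counting of pairs of an orbit and a point on it; each point lies on exactly one orbit. *)
transitivity (\sum_(gamma <- S | (#|` fset_set (val gamma)| %| n)%N)
    \sum_(x <- E | x \in val gamma) 1)%N.
  apply: eq_bigr => gamma Dg; rewrite sum1_count -size_filter.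
  apply/perm_size/uniq_perm; rewrite ?filter_uniq // => x.
  rewrite mem_filter !in_fset_set //; last exact: finite_Per.
  apply/idP/andP => [gx|[]//]; split=> //; apply/mem_set/(perD gamma) => //.
  exact: set_mem.
rewrite (exchange_big_dep predT) //= big_seq [RHS]big_seq; apply: eq_bigr => x.
rewrite in_fset_set; last exact: finite_Per.
move=> /set_mem xn; have [orb dv] := (Per_orbit x n0).1 xn.
pose g : P_orb A := exist (fun y => y \in P_orb A) _ (mem_set orb).
have gS : g \in S.
  by apply: (fsubsetP DS); rewrite in_fset_set //; apply/mem_set.
apply: etrans (@fbig_pred1_inj _ _ addn _ _ (fun=> 1%N) id S g gS (@inj_id _)).
apply: eq_bigl => gamma.
apply/andP/eqP => [[_ /set_mem gx]|->].
  by apply: val_inj => /=; have [] := P_orb_in (set_valP gamma) gx.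
by split=> //; apply/mem_set; exact: orbit2_refl.
Qed.

Lemma zeta_euler_product :
  fps_has_prod (fun gamma : P_orb A => (1 - fpsX ^+ #|` fset_set (val gamma)|)^-1) (zeta A).
Proof. exact: euler_product P_orb_card_gt0 sum_card_P_orb. Qed.

(** Some iterates of [x] and [x'] have the same projection; being periodic, they coincide by
    [piX_periodic_inj]. *)
Lemma P_orb_eq_of_lag (gamma gamma' : set (twoX A)) x x' m :
  P_orb A gamma -> P_orb A gamma' -> gamma x -> gamma' x' ->
  lag (piX x) m (piX x') -> gamma = gamma'.
Proof.
move=> /P_orb_in H /P_orb_in H' /H[-> [p [p0 xp]]] /H'[-> [q [q0 xq]]] [a [b [ab _]]].
apply/orbit2_eq/orbit2P; exists a, b; apply: (piX_periodic_inj p0 q0); last by rewrite !piX_iter.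
  by rewrite -iterD addnC iterD; congr iter; apply/xp.
by rewrite -iterD addnC iterD; congr iter; apply/xq.
Qed.

Lemma P_orb_lag (gamma : set (twoX A)) x x' : P_orb A gamma -> gamma x -> gamma x' ->
  exists m, lag (piX x) m (piX x').
Proof.
move=> /P_orb_in H /H[-> _] /orbit2P[a [b ab]]; exists (a%:Z - b%:Z), a, b.
by split=> //; rewrite -!piX_iter ab.
Qed.

End TwoSided.

(** * The correspondence of periodic orbits *)

(** A lag instead of an equality, because [h (piX x)] is in general only eventually periodic. *)
Definition orbit_rel N M (A : 'M[nat]_N) (B : 'M[nat]_M) (h : oneX A -> oneX B)
    (gamma : set (twoX A)) (delta : set (twoX B)) :=
  exists x y m, [/\ gamma x, delta y & lag (h (piX x)) m (piX y)].

Section OrbitCorrespondence.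
Variables (N M : nat) (A : 'M[nat]_N) (B : 'M[nat]_M).
Variables (h : oneX A -> oneX B) (hinv : oneX B -> oneX A).

(** [h] preserves tail equivalence, and distinct periodic orbits are never tail equivalent. *)
Lemma orbit_rel_unique (k l : oneX A -> nat) gamma delta delta' : orbit_cocycle h k l ->
  P_orb A gamma -> P_orb B delta -> P_orb B delta' ->
  orbit_rel h gamma delta -> orbit_rel h gamma delta' -> delta = delta'.
Proof.
move=> eqh gP dP dP' [x [y [m [gx dy xy]]]] [x' [y' [m' [gx' dy' xy']]]].
have [n /(orbit_cocycle_tail eqh)[n' xx']] := P_orb_lag gP gx gx'.
exact: P_orb_eq_of_lag dP dP' dy dy' (lag_trans (lag_sym xy) (lag_trans xx' xy')).
Qed.

Lemma orbit_rel_sym (k l : oneX B -> nat) gamma delta : orbit_cocycle hinv k l ->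
  cancel h hinv -> orbit_rel h gamma delta -> orbit_rel hinv delta gamma.
Proof.
move=> eqh hK [x [y [m [gx dy /(orbit_cocycle_tail eqh)[n]]]]]; rewrite hK => xy.
by exists y, x, (- n); split=> //; apply: lag_sym.
Qed.

End OrbitCorrespondence.

Section OrbitEquivalence.
Variables (N M : nat) (A : 'M[nat]_N) (B : 'M[nat]_M).
Hypotheses (A_I : condition_I A) (B_I : condition_I B).
Variables (h : oneX A -> oneX B) (hinv : oneX B -> oneX A).
Hypothesis h_homeo : homeo_inverse h hinv.
Variables (k1 l1 : oneX A -> nat) (k2 l2 : oneX B -> nat).
Hypothesis (k1_cont : continuous k1) (l1_cont : continuous l1).
Hypothesis (k2_cont : continuous k2) (l2_cont : continuous l2).
Hypothesis (eq1 : orbit_cocycle h k1 l1) (eq2 : orbit_cocycle hinv k2 l2).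
Let c1 (x : oneX A) : int := (l1 x)%:Z - (k1 x)%:Z.

(** The periodic point given by [orbit_equivalence_period] lifts to the two-sided shift with the
    same least period; its orbit is [delta]. *)
Lemma orbit_rel_total (gamma : P_orb A) : exists delta : P_orb B,
  orbit_rel h (val gamma) (val delta) /\
  beta (val gamma) c1 = #|` fset_set (val delta)|%:Z.
Proof.
have [/continuous_cyl h_cyl /continuous_cyl hinv_cyl hK hinvK] := h_homeo.
have lc := @continuous_nat_locally_constant.
have /P_orbP[x [p [xp gE]]] := set_valP gamma.
have [a [n [c1a [a0 yP]]]] := orbit_equivalence_period A_I B_I hK hinvK h_cyl hinv_cyl
  (lc _ _ _ k1_cont) (lc _ _ _ l1_cont) (lc _ _ _ k2_cont) (lc _ _ _ l2_cont)
  eq1 eq2 (has_minimal_period_piX xp).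
have [|y ya yE] := @piX_periodic_surj _ B a (iter n (@sigma M B) (h (piX x))) a0.
  exact/yP.
have yp : has_minimal_period (@sigma2 M B) y a.
  split=> // m; rewrite -yP -yE -piX_iter; split=> [->//|ym].
  apply: (@piX_periodic_inj _ _ a a) => //.
  by rewrite -iterD addnC iterD ya.
have dP : P_orb B (orbit2 y) by apply/P_orbP; exists y, a.
exists (exist (fun d => d \in P_orb B) _ (mem_set dP)); split=> /=.
  exists x, y, n%:Z; rewrite gE; split; [exact: orbit2_refl|exact: orbit2_refl|].
  by rewrite yE; exact: lag_iter.
by rewrite gE (beta_orbit2 _ xp) c1a (card_orbit2 yp).
Qed.

End OrbitEquivalence.

Section ZetaCocycle.
Variables (N M : nat) (A : 'M[nat]_N) (B : 'M[nat]_M).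
Hypotheses (A_I : condition_I A) (B_I : condition_I B).
Variables (h : oneX A -> oneX B) (hinv : oneX B -> oneX A).
Hypothesis h_homeo : homeo_inverse h hinv.
Variables (k1 l1 : oneX A -> nat) (k2 l2 : oneX B -> nat).
Hypothesis (k1_cont : continuous k1) (l1_cont : continuous l1).
Hypothesis (k2_cont : continuous k2) (l2_cont : continuous l2).
Hypothesis (eq1 : orbit_cocycle h k1 l1) (eq2 : orbit_cocycle hinv k2 l2).
Let c1 (x : oneX A) : int := (l1 x)%:Z - (k1 x)%:Z.

(** Totality for [h] and [hinv], with symmetry and uniqueness, makes [orbit_rel] the graph of a
    bijection [e]. Reindexing the Euler product of [zeta B] along [e] gives the product for [c1],
    whose exponents are positive as sizes of orbits. *)
Lemma zeta_cocycleE : zeta_cocycle_defined c1 /\ zeta B = zeta_cocycle c1.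
Proof.
have [hc hic hK hinvK] := h_homeo; have hinv_homeo : homeo_inverse hinv h by [].
have /choice[e eP] := orbit_rel_total A_I B_I h_homeo k1_cont l1_cont k2_cont l2_cont eq1 eq2.
have /choice[d dP] :=
  orbit_rel_total B_I A_I hinv_homeo k2_cont l2_cont k1_cont l1_cont eq2 eq1.
have e_bij : bijective e.
  exists d => [gamma|delta]; apply: val_inj.
    have ge := orbit_rel_sym eq2 hK (eP gamma).1.
    exact: orbit_rel_unique eq2 (set_valP _) (set_valP _) (set_valP _) (dP (e gamma)).1 ge.
  have de := orbit_rel_sym eq1 hinvK (dP delta).1.
  exact: orbit_rel_unique eq1 (set_valP _) (set_valP _) (set_valP _) (eP (d delta)).1 de.
have prod_c1 : fps_has_prod (zeta_factor c1) (zeta B).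
  have := fps_has_prod_reindex e_bij (zeta_euler_product B).
  congr fps_has_prod; apply/funext => gamma.
  by rewrite /zeta_factor (eP gamma).2 absz_nat.
split; last by rewrite /zeta_cocycle (fps_prodP prod_c1).
split; last by exists (zeta B).
move=> gamma gP; pose g : P_orb A := exist (fun d => d \in P_orb A) _ (mem_set gP).
by rewrite -[gamma]/(val g) (eP g).2 ltz_nat P_orb_card_gt0.
Qed.

End ZetaCocycle.

Theorem theorem6p7 (N M : nat) (A : 'M[nat]_N) (B : 'M[nat]_M)
  (N_gt1 : (1 < N)%N) (M_gt1 : (1 < M)%N)
  (A01 : zero_one A) (B01 : zero_one B)
  (A_irr : irreducible_mx A) (B_irr : irreducible_mx B)
  (A_I : condition_I A) (B_I : condition_I B)
  (h : oneX A -> oneX B) (hinv : oneX B -> oneX A)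
  (h_homeo : homeo_inverse h hinv)
  (k1 l1 : oneX A -> nat) (k2 l2 : oneX B -> nat)
  (k1_cont : continuous k1) (l1_cont : continuous l1)
  (k2_cont : continuous k2) (l2_cont : continuous l2)
  (eq1 : orbit_cocycle h k1 l1) (eq2 : orbit_cocycle hinv k2 l2) :
  let c1 : oneX A -> int := fun x => (l1 x)%:Z - (k1 x)%:Z in
  let c2 : oneX B -> int := fun y => (l2 y)%:Z - (k2 y)%:Z in
  [/\ zeta_cocycle_defined c1, zeta_cocycle_defined c2,
      zeta A = zeta_cocycle c2 & zeta B = zeta_cocycle c1].
Proof.
move=> c1 c2.
have [c1_def zetaB] := zeta_cocycleE A_I B_I h_homeo k1_cont l1_cont k2_cont l2_cont eq1 eq2.
have hinv_homeo : homeo_inverse hinv h by case: h_homeo.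
have [c2_def zetaA] := zeta_cocycleE B_I A_I hinv_homeo k2_cont l2_cont k1_cont l1_cont eq2 eq1.
exact (And4 c1_def c2_def zetaA zetaB).
Qed.
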